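(* Consider the principal $H$-bundle $\pi:G\to G/H$, where $G$ is a log-Euclidean Lie group with Lie algebra $\mathfrak g$ and $H$ is a closed connected (hence normal) subgroup of $G$ with Lie algebra $\mathfrak h\subset\mathfrak g$. Then there is a one-to-one correspondence between group-homomorphic sections of $\pi$ and $\mathbb R$-linear splittings of the short exact sequence $$0\longrightarrow\mathfrak h\xrightarrow{\ i\ }\mathfrak g\xrightarrow{\ \mathrm d_{e_G}\pi\ }\mathfrak g/\mathfrak h\longrightarrow0.$$
   Context: A log-Euclidean Lie group is a smooth manifold $G$ with a diffeomorphism $\log_G:G\to\mathfrak g$ onto a finite-dimensional real vector space $\mathfrak g$ (identified with its Lie algebra $T_{e_G}G$), with inverse $\exp_G$ (the Lie exponential), equipped with the commutative Lie group law $u\star v=\exp_G(\log_G(u)+\log_G(v))$; its identity element is $e_G=\exp_G(0)$. For a closed connected subgroup $H$, $\mathfrak h=\log_G(H)$ is a linear subspace of $\mathfrak g$. The map $\pi:G\to G/H$, $g\mapsto[g]=gH$, is the quotient map, a principal $H$-bundle for right multiplication by $H$. The tangent space $T_{[e_G]}(G/H)$ is identified with $\mathfrak g/\mathfrak h$ so that $\mathrm d_{e_G}\pi(X)=X+\mathfrak h$, and $i$ is the inclusion. A group-homomorphic section of $\pi$ is a smooth group homomorphism $s:G/H\to G$ with $\pi\circ s=\mathrm{id}_{G/H}$. An $\mathbb R$-linear splitting of the sequence is a linear map $s_{\mathrm{lin}}:\mathfrak g/\mathfrak h\to\mathfrak g$ with $\mathrm d_{e_G}\pi\circ s_{\mathrm{lin}}=\mathrm{id}_{\mathfrak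 g/\mathfrak h}$. *)

(* Defs.v *)
From HB Require Import structures.
From mathcomp Require Import all_boot all_order all_algebra.
From mathcomp Require Import all_classical all_reals all_analysis.

Set Implicit Arguments.
Unset Strict Implicit.
Unset Printing Implicit Defensive.

Import Order.TTheory GRing.Theory Num.Theory.
Import numFieldNormedType.Exports.
Import VectorInternalTheory.

Local Open Scope classical_set_scope.
Local Open Scope ring_scope.
Local Open Scope quotient_scope.

Section LinearFacts.

Lemma rV_linear_continuous (R : realType) m n
  (f : {linear 'rV[R]_m -> 'rV[R]_n}) : continuous f.
Proof.
have -> : (f : _ -> _) = (fun x => \sum_j x ord0 j *: f (delta_mx ord0 j)).
  apply/funext => x; rewrite [in LHS](row_sum_delta x) linear_sum /=.
  by apply: eq_bigr => j _; rewrite linearZ.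
apply: continuous_big => [|j _ x]; first exact: add_continuous.
by apply: (@cvgZr_tmp _ _ _ (nbhs x)); exact: coord_continuous.
Qed.

Lemma vspace_of_pred (K : fieldType) (vT : vectType K) (P : set vT) :
  P 0 -> (forall a x y, P x -> P y -> P (a *: x + y)) ->
  exists U : {vspace vT}, [set x | x \in U] = P.
Proof.
move=> P0 Plin.
pose Q n := `[< exists2 U : {vspace vT}, \dim U = n & [set x | x \in U] `<=` P >].
have exQ : exists n, Q n.
  exists 0%N; apply/asboolP; exists 0%VS; first exact: dimv0.
  by move=> x /=; rewrite memv0 => /eqP ->.
have Qle n : Q n -> (n <= \dim {:vT})%N.
  by move=> /asboolP[U <- _]; rewrite dimvS ?subvf.
case: (ex_maxnP exQ Qle) => n /asboolP[U dU UP] maxn.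
exists U; apply/seteqP; split => // x Px.
have /maxn : Q (\dim (U + <[x]>)).
  apply/asboolP; exists (U + <[x]>)%VS => // z /memv_addP[u uU [_ /vlineP[k ->] ->]].
  by rewrite addrC; apply: Plin => //; apply: UP.
rewrite -dU => dle /=.
have /eqP E : U == (U + <[x]>)%VS by rewrite eqEdim addvSl dle.
by rewrite E; apply: (subvP (addvSr _ _)); rewrite memv_line.
Qed.

End LinearFacts.

Section ClosedConnectedSubgroups.
Variables (R : realType) (n : nat) (A : set 'rV[R]_n).
Hypotheses (A0 : A 0) (AB : forall x y, A x -> A y -> A (x - y)).
Hypotheses (Acl : closed A) (Aco : connected A).

Let AN x : A x -> A (- x).
Proof. by move=> Ax; rewrite -sub0r; apply: AB. Qed.

Let AD x y : A x -> A y -> A (x + y).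
Proof. by move=> Ax Ay; rewrite -[y]opprK; apply: AB => //; apply: AN. Qed.

Let AMn x k : A x -> A (x *+ k).
Proof. by move=> Ax; elim: k => [|k IH]; rewrite ?mulr0n// mulrS; apply: AD. Qed.

Let AMz x (k : int) : A x -> A (x *~ k).
Proof. by case: k => k Ax; [exact: AMn | rewrite NegzE mulrNz; apply/AN/AMn]. Qed.

Let B : set 'rV[R]_n := [set x | forall t : R, A (t *: x)].

Let BA : B `<=` A.
Proof. by move=> x /(_ 1); rewrite scale1r. Qed.

Let Blin a x y : B x -> B y -> B (a *: x + y).
Proof. by move=> Bx By t; rewrite scalerDr scalerA; apply: AD. Qed.

Let Bcl : closed B.
Proof.
have -> : B = \bigcap_(t in setT) [set x | A (t *: x)].
  by apply/seteqP; split => [x Bx t _|x Bx t]; apply: Bx.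
apply: closed_bigI => t _; apply: (preimage_closed (f := fun x : 'rV[R]_n => t *: x)) => //.
by move=> x _; apply: scaler_continuous.
Qed.

(* Near 0 the subgroup A consists of elements generating a line inside A. *)
Let Bnear : exists2 r : R, 0 < r & forall x, A x -> `|x| < r -> B x.
Proof.
apply: contrapT => noR.
have [U UB] : exists U : {vspace 'rV[R]_n}, [set x | x \in U] = B.
  by apply: vspace_of_pred => // t; rewrite scaler0.
have UBE x : x \in U <-> B x by rewrite -UB.
have /choice[x xP] (k : nat) : exists x, [/\ A x, projv U x = 0, x != 0 & `|x| < k.+1%:R^-1].
  have cP : {for (0 : 'rV[R]_n), continuous (fun x : 'rV[R]_n => x - projv U x)}.
    apply: continuousB; first exact: cvg_id.
    exact: (@rV_linear_continuous _ _ _ (projv U)).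
  move: cP => /cvgrPdist_lt /(_ k.+1%:R^-1) /=.
  rewrite linear0 subr0 invr_gt0 ltr0n => /(_ isT) /nbhs_ballP[r /= r0 rP].
  have /existsNP[x /not_implyP[Ax /not_implyP[xr nBx]]] :
    ~ forall x, A x -> `|x| < r -> B x by move=> H; apply: noR; exists r.
  exists (x - projv U x).
  have BP : B (projv U x) by apply/UBE/memv_proj.
  split.
  - by apply: AB => //; apply: BA.
  - by rewrite linearB /= projv_proj subrr.
  - by apply/eqP => /eqP; rewrite subr_eq0 => /eqP xE; apply: nBx; rewrite xE.
  - have := rP x; rewrite -ball_normE /= sub0r normrN => /(_ xr).
    by rewrite sub0r normrN.
pose y k := `|x k|^-1 *: x k.
have ny k : `|y k| = 1.
  have [_ _ x0 _] := xP k.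
  by rewrite normrZ normfV normr_id mulVf ?normr_eq0.
pose K := [set w : 'rV[R]_n | `|w| = 1] `&` [set w | projv U w = 0].
have Kco : compact K.
  apply: bounded_closed_compact.
    by exists 1; split => // M M1 w [/= -> _]; exact: ltW.
  apply: closedI.
    apply: (@preimage_closed _ _ (fun w : 'rV[R]_n => `|w|) [set (1 : R)]).
      by move=> w _; exact: norm_continuous.
    exact: closed_eq.
  apply: (@preimage_closed _ _ (projv U) [set 0]).
    by move=> w _; exact: (@rV_linear_continuous _ _ _ (projv U)).
  exact: accessible_closed_set1 (hausdorff_accessible (@norm_hausdorff _ _)) _.
have Ky k : K (y k).
  by split; [exact: ny | have [_ px _ _] := xP k; rewrite /= linearZ /= px scaler0].
have [w [[/= nw pw] clw]] : K `&` cluster (y @ \oo) !=set0.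
  by apply: Kco; exists 0%N => // k _; exact: Ky.
suff Bw : B w.
  move: pw; rewrite projv_id; last exact/UBE.
  by move=> w0; move/eqP: nw; rewrite w0 normr0 eq_sym oner_eq0.
move=> t; apply: Acl => V /nbhs_ballP[e /= e0 eV].
pose d := e / (2 * (`|t| + 1)).
have d0 : 0 < d by rewrite divr_gt0// mulr_gt0// ltr_wpDl.
have [N NP] : exists N : nat, forall k, (N <= k)%N -> k.+1%:R^-1 < e / 2.
  have e20 : 0 < e / 2 by rewrite divr_gt0.
  exists (Num.truncn (e / 2)^-1) => k Nk.
  rewrite invf_plt ?posrE// ?ltr0n//.
  apply: lt_le_trans (truncnS_gt _) _.
  by rewrite ler_nat ltnS.
have [z [/= [k Nk <-] yw]] := clw (y @` [set k | (N <= k)%N]) (ball w d)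
  (ltac:(by exists N => // k Nk /=; exists k)) (nbhsx_ballx w d d0).
have [Ax _ x0 xk] := xP k.
have nx0 : 0 < `|x k| by rewrite normr_gt0.
pose m := Num.floor (t / `|x k|).
exists (x k *~ m); split; first exact: AMz.
apply: eV; rewrite -ball_normE /=.
have -> : t *: w - x k *~ m = t *: (w - y k) + (t / `|x k| - m%:~R) *: x k.
  rewrite scalerBr scalerBl /y scalerA scaler_int addrA; congr (_ - _).
  by rewrite subrK.
have yw' : `|w - y k| < d by move: yw; rewrite -ball_normE.
apply: (le_lt_trans (ler_normD _ _)); rewrite !normrZ [ltRHS]splitr.
apply: ler_ltD.
  have : `|t| * `|w - y k| <= (`|t| + 1) * d.
    by apply: ler_pM => //; [rewrite lerDl | exact: ltW].
  move/le_trans; apply; rewrite /d.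
  have t1 : `|t| + 1 != 0 by rewrite gt_eqF// ltr_wpDl.
  by rewrite invfM mulrCA [X in e * X]mulrCA mulfV// mulr1.
apply: le_lt_trans (_ : `|x k| < _); last first.
  by apply: lt_trans xk _; exact: NP.
rewrite ger0_norm; last by rewrite subr_ge0 floor_le.
by rewrite -[leRHS]mul1r ler_wpM2r// lerBlDr addrC -intrD1 ltW// floorD1_gt.
Qed.

Lemma closed_connected_subgroupZ (t : R) x : A x -> A (t *: x).
Proof.
have [r r0 rB] := Bnear.
suff E : B = A by rewrite -{1}E; apply.
apply: Aco.
- by exists 0 => s; rewrite scaler0.
- exists (\bigcup_(b in B) ball b r).
    by apply: bigcup_open => b _; exact: ball_open.
  apply/seteqP; split => [b Bb|a [Aa [b Bb]]].
    by split; [exact: BA | exists b => //; exact: ballxx].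
  rewrite -ball_normE /= => abr.
  have Bab : B (b - a) by apply: rB => //; apply: AB => //; apply: BA.
  have -> : a = -1 *: (b - a) + b by rewrite scaleN1r opprB subrK.
  exact: Blin.
- exists B => //; apply/seteqP; split => [b Bb|b []//].
  by split => //; exact: BA.
Qed.

End ClosedConnectedSubgroups.

Section Smooth.
Variable R : realType.

(* A map between coordinate spaces is C^(k+1) when it is differentiable and all
   its directional derivatives are C^k; in finite dimension this is the usual
   notion. *)
Fixpoint Ck (m n k : nat) (f : 'rV[R]_m -> 'rV[R]_n) : Prop :=
  if k is k'.+1 then
    (forall x, differentiable f x) /\ (forall v, Ck k' (fun x => 'd f x v))
  else continuous f.

(* [v2r] and [r2v] are the linear coordinates, inverse to each other, carried by
   every finite-dimensional vector space. *)
Definition smooth_vect (V W : vectType R) (f : V -> W) : Prop :=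
  forall k, Ck k (v2r \o f \o r2v).

Definition diff_vect (V W : vectType R) (f : V -> W) (x : V) : 'Hom(V, W) :=
  linfun (r2v \o 'd (v2r \o f \o r2v) (v2r x) \o v2r).

Lemma Ck_cst m n k (c : 'rV[R]_n) : @Ck m n k (cst c).
Proof.
elim: k c => [|k IH] c /=; first exact: cst_continuous.
split=> [x|v]; first exact: differentiable_cst.
have -> : (fun x : 'rV[R]_m => 'd (cst c) x v) = cst 0; last exact: IH.
by apply/funext => x; rewrite diff_cst.
Qed.

Lemma Ck_linear m n k (f : {linear 'rV[R]_m -> 'rV[R]_n}) : Ck k f.
Proof.
have fc : continuous f by exact: rV_linear_continuous.
case: k => [//|k]; split=> [x|v]; first exact: linear_differentiable.
have -> : (fun x => 'd f x v) = cst (f v); last exact: Ck_cst.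
by apply/funext => x; rewrite diff_lin.
Qed.

Lemma smooth_vect_linear (V W : vectType R) (f : {linear V -> W}) :
  smooth_vect f.
Proof. by move=> k; exact: (Ck_linear k (v2r \o f \o r2v)). Qed.

Lemma diff_vect_linear (V W : vectType R) (f : {linear V -> W}) x :
  diff_vect f x =1 f.
Proof.
move=> y; rewrite lfunE /=.
by rewrite (diff_lin _ (@rV_linear_continuous _ _ _ (v2r \o f \o r2v))) /= !v2rK.
Qed.

End Smooth.

(* A smooth manifold M together with a diffeomorphism [chart] onto the
   finite-dimensional vector space V.  As [chart] is a diffeomorphism, the smooth
   structure of M is the one generated by this single global chart. *)
HB.mixin Record hasGlobalChart (R : realType) (V : vectType R) M
    of Topological M := {
  chart : M -> V;
  unchart : V -> M;
  chartK : cancel chart unchart;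
  unchartK : cancel unchart chart;
  chart_continuous : continuous (v2r \o chart);
  unchart_continuous : continuous (unchart \o r2v)
}.

#[short(type="globalChartType")]
HB.structure Definition GlobalChart (R : realType) (V : vectType R) :=
  { M of hasGlobalChart R V M & Topological M }.

Arguments chart {R V M} : rename.
Arguments unchart {R V M} : rename.

Section SmoothMaps.
Variables (R : realType) (V W : vectType R).
Variables (M : globalChartType V) (N : globalChartType W).

Definition smooth (f : M -> N) : Prop := smooth_vect (chart \o f \o unchart).

(* The differential of f at x; the tangent spaces of M and N are identified with
   V and W by the differentials of the global charts. *)
Definition tangent_map (f : M -> N) (x : M) : 'Hom(V, W) :=
  diff_vect (chart \o f \o unchart) (chart x).

End SmoothMaps.

(* log_G is [chart] and exp_G is [unchart]; the neutral element of the group is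
   then exp_G 0, see [unchart0]. *)
HB.mixin Record isLogEuclidean (R : realType) (V : vectType R) G
    of GlobalChart R V G & Group G := {
  log_euclidean_mulE :
    forall u v : G, (u * v)%g = unchart (chart u + chart v : V)
}.

#[short(type="logEuclideanType")]
HB.structure Definition LogEuclidean (R : realType) (V : vectType R) :=
  { G of isLogEuclidean R V G & GlobalChart R V G & Group G }.


Section LogEuclideanTheory.
Variables (R : realType) (g : vectType R) (G : logEuclideanType g).
Implicit Types u v : G.

Lemma chartM u v : chart (u * v)%g = chart u + chart v.
Proof. by rewrite log_euclidean_mulE unchartK. Qed.

Lemma unchartD (x y : g) : unchart (x + y) = (unchart x * unchart y)%g :> G.
Proof. by rewrite log_euclidean_mulE !unchartK. Qed.

Lemma chart1 : chart (1%g : G) = 0.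
Proof. by apply: (addrI (chart (1%g : G))); rewrite -chartM mulg1 addr0. Qed.

Lemma unchart0 : unchart 0 = 1%g :> G.
Proof. by rewrite -chart1 chartK. Qed.

Lemma chartV u : chart u^-1%g = - chart u.
Proof. by apply/eqP; rewrite -addr_eq0 -chartM mulVg chart1. Qed.

Lemma log_euclidean_mulC u v : (u * v = v * u)%g.
Proof. by rewrite !log_euclidean_mulE addrC. Qed.

End LogEuclideanTheory.

Section VectorQuotient.
Variables (K : fieldType) (V : vectType K) (U : {vspace V}).

Definition vquot : Type := Quotient.quot (pred_of_vspace U).

HB.instance Definition _ := GRing.Zmodule.on vquot.
HB.instance Definition _ := Quotient.on vquot.

Lemma vquotP (x y : V) : reflect (\pi_vquot x = \pi_vquot y) (x - y \in U).
Proof. by rewrite -[_ \in U]/(x - y \in pred_of_vspace U) Quotient.idealrBE; exact: eqP. Qed.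

Lemma pi_vquotD : {morph \pi_vquot : x y / x + y}.
Proof. exact: Quotient.pi_add. Qed.

Definition vquot_scale (a : K) (q : vquot) : vquot := \pi_vquot (a *: repr q).

Lemma pi_vquotZ a x : \pi_vquot (a *: x) = vquot_scale a (\pi_vquot x).
Proof. by rewrite /vquot_scale; apply/vquotP; rewrite -scalerBr rpredZ//; apply/vquotP; rewrite reprK. Qed.

Fact vquot_scaleA a b q : vquot_scale a (vquot_scale b q) = vquot_scale (a * b) q.
Proof. by elim/quotW: q => x; rewrite -(pi_vquotZ b x) -(pi_vquotZ a) -pi_vquotZ scalerA. Qed.

Fact vquot_scale1 : left_id 1 vquot_scale.
Proof. by elim/quotW => x; rewrite -pi_vquotZ scale1r. Qed.

Fact vquot_scaleDr : right_distributive vquot_scale +%R.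
Proof.
move=> a; elim/quotW => x; elim/quotW => y.
by rewrite -pi_vquotD -(pi_vquotZ a x) -(pi_vquotZ a y) -pi_vquotZ scalerDr pi_vquotD.
Qed.

Fact vquot_scaleDl q : {morph vquot_scale^~ q : a b / a + b}.
Proof. by elim/quotW: q => x a b; rewrite -(pi_vquotZ a x) -(pi_vquotZ b x) -pi_vquotZ scalerDl pi_vquotD. Qed.

HB.instance Definition _ := GRing.Zmodule_isLmodule.Build K vquot
  vquot_scaleA vquot_scale1 vquot_scaleDr vquot_scaleDl.

Definition vproj (x : V) : vquot := \pi_vquot x.

Fact vproj_is_linear : linear vproj.
Proof. by move=> a x y; rewrite /vproj pi_vquotD pi_vquotZ. Qed.
HB.instance Definition _ := GRing.isLinear.Build K V vquot _ vproj vproj_is_linear.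

Lemma vproj_eq0 x : (vproj x == 0) = (x \in U).
Proof.
rewrite -[x in RHS]subr0 -(linear0 vproj); apply/eqP/vquotP => //.
Qed.

(* The linear section of [vproj] with values in the complement [U^C]. *)
Definition vlift (q : vquot) : V := repr q - projv U (repr q).

Lemma vliftE x : vlift (vproj x) = x - projv U x.
Proof.
rewrite /vlift; set r := repr _.
have E : projv U (x - r) = x - r by rewrite projv_id//; apply/vquotP; rewrite reprK.
by rewrite -{1}[r](subKr x) -E linearB /= opprB addrA addrAC addrK.
Qed.

Lemma vliftK : cancel vlift vproj.
Proof.
elim/quotW => x; rewrite -/(vproj x) vliftE linearB /=.
by apply/eqP; rewrite subr_eq addrC -subr_eq subrr eq_sym vproj_eq0 memv_proj.
Qed.

Fact vlift_is_linear : linear vlift.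
Proof.
move=> a; elim/quotW => x; elim/quotW => y; rewrite -/(vproj x) -/(vproj y).
by rewrite -linearP !vliftE linearP /= scalerBr opprD addrACA.
Qed.
HB.instance Definition _ := GRing.isLinear.Build K vquot V _ vlift vlift_is_linear.

Fact vquot_findim : Vector.axiom (dim (subvs_of (U^C)%VS)) vquot.
Proof.
exists (v2r \o vsproj (U^C)%VS \o vlift); first by move=> a p q /=; rewrite !linearP.
exists (vproj \o vsval \o r2v) => [q|r] /=.
  rewrite v2rK vsprojK ?vliftK//.
  by elim/quotW: q => x; rewrite -/(vproj x) vliftE memv_projC.
have Cw : projv U (vsval (r2v r : subvs_of (U^C)%VS)) = 0.
  by apply/eqP; rewrite -memv_ker lker_proj subvsP.
by rewrite vliftE Cw subr0 vsvalK r2vK.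
Qed.
HB.instance Definition _ := Lmodule_hasFinDim.Build K vquot vquot_findim.

End VectorQuotient.

Section Quotient.
Variables (R : realType) (g : vectType R) (G : logEuclideanType g).

Record closedConnectedSubgroup := ClosedConnectedSubgroup {
  ccs_set :> set G;
  ccs1 : ccs_set 1%g;
  ccsM : forall u v, ccs_set u -> ccs_set v -> ccs_set (u * v)%g;
  ccsV : forall u, ccs_set u -> ccs_set u^-1%g;
  ccs_closed : closed ccs_set;
  ccs_connected : connected ccs_set
}.

Variable H : closedConnectedSubgroup.

Lemma log_subgroup_subspace :
  exists h : {vspace g}, [set x | x \in h] = chart @` H.
Proof.
pose A := (unchart \o r2v) @^-1` H : set 'rV[R]_(dim g).
have AE : A = (v2r \o chart) @` H.
  apply/seteqP; split => [x Ax|_ [u Hu <-]]; last by rewrite /A /= v2rK chartK.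
  by exists (unchart (r2v x)); rewrite //= unchartK r2vK.
have A0 : A 0 by rewrite /A /= linear0 unchart0; exact: ccs1.
have AB x y : A x -> A y -> A (x - y).
  rewrite /A /= linearB unchartD => Ax Ay; apply: ccsM => //.
  suff -> : unchart (- r2v y) = (unchart (r2v y : g) : G)^-1%g by exact: ccsV.
  by rewrite -[RHS]chartK chartV unchartK.
have Acl : closed A.
  apply: preimage_closed; last exact: ccs_closed.
  by move=> x _; exact: unchart_continuous.
have Aco : connected A.
  rewrite AE; apply: connected_continuous_connected; first exact: ccs_connected.
  by apply: continuous_subspaceT => u; exact: chart_continuous.
have AZ := closed_connected_subgroupZ A0 AB Acl Aco.
have HE : chart @` H = [set x | A (v2r x)].
  apply/seteqP; split => [_ [u Hu <-]|x]; first by rewrite /A /= v2rK chartK.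
  by rewrite /A /= v2rK => Hx; exists (unchart x); rewrite // unchartK.
rewrite HE; apply: vspace_of_pred => [|a x y Ax Ay].
  by rewrite /mkset linear0.
rewrite /mkset (_ : v2r _ = a *: v2r x - (- 1) *: v2r y).
  by apply: AB; apply: AZ.
by rewrite scaleN1r opprK linearP.
Qed.

(* h = log_G(H), as a subspace of g. *)
Definition lie_algebra : {vspace g} := sval (cid log_subgroup_subspace).

Lemma lie_algebraE : [set x | x \in lie_algebra] = chart @` H.
Proof. by rewrite /lie_algebra; case: cid. Qed.

Lemma lie_algebraP u : (chart u \in lie_algebra) <-> ccs_set H u.
Proof.
have -> : (chart u \in lie_algebra : Prop) = (chart @` H) (chart u).
  by rewrite -lie_algebraE.
by split => [[v Hv /(can_inj chartK) <-//]|Hu]; exists u.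
Qed.

(* uH = vH *)
Definition same_lcoset (u v : G) : bool := `[< ccs_set H (u^-1 * v)%g >].

Fact same_lcoset_equiv : equiv_class_of same_lcoset.
Proof.
split => [u|u v|v u w].
- by apply/asboolP; rewrite mulVg; exact: ccs1.
- by apply/asboolP/asboolP => /ccsV; rewrite invgM invgK.
- move=> /asboolP uv /asboolP vw; apply/asboolP.
  by have := ccsM uv vw; rewrite mulgA mulgK.
Qed.

Canonical same_lcoset_equiv_rel := EquivRelPack same_lcoset_equiv.
Canonical same_lcoset_encModRel := defaultEncModRel same_lcoset.

(* The space G/H of left cosets, with the quotient topology. *)
Definition coset_space : Type := quotient_topology {eq_quot same_lcoset}.

HB.instance Definition _ := Quotient.on coset_space.
HB.instance Definition _ := Topological.on coset_space.

Definition coset_proj (u : G) : coset_space := \pi_coset_space u.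

Lemma coset_projP u v : coset_proj u = coset_proj v <-> ccs_set H (u^-1 * v)%g.
Proof.
have E : (u == v %[mod {eq_quot same_lcoset}]) = same_lcoset u v by exact: eqmodE.
split => [uv|uv]; first by apply/asboolP; rewrite -[asbool _]/(same_lcoset u v) -E; apply/eqP.
by move/asboolP: uv; rewrite -[asbool _]/(same_lcoset u v) -E => /eqP.
Qed.

Lemma coset_projW (P : coset_space -> Prop) :
  (forall u, P (coset_proj u)) -> forall q, P q.
Proof. by move=> Pu; elim/quotW. Qed.

Lemma repr_coset (q : coset_space) : coset_proj (repr q) = q.
Proof. exact: reprK. Qed.

Definition coset_mul (p q : coset_space) : coset_space :=
  coset_proj (repr p * repr q)%g.
Definition coset_inv (p : coset_space) : coset_space := coset_proj (repr p)^-1%g.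

Lemma coset_projM u v :
  coset_mul (coset_proj u) (coset_proj v) = coset_proj (u * v)%g.
Proof.
have /coset_projP Hu := repr_coset (coset_proj u).
have /coset_projP Hv := repr_coset (coset_proj v).
apply/coset_projP; have := ccsM Hu Hv; congr (ccs_set H _).
by apply: (can_inj chartK); rewrite !(chartM, chartV) opprD addrACA.
Qed.

Fact coset_mulA : associative coset_mul.
Proof.
elim/coset_projW => u; elim/coset_projW => v; elim/coset_projW => w.
by rewrite !coset_projM mulgA.
Qed.

Fact coset_mul1 : left_id (coset_proj 1%g) coset_mul.
Proof. by elim/coset_projW => u; rewrite coset_projM mul1g. Qed.

Fact coset_mulr1 : right_id (coset_proj 1%g) coset_mul.
Proof. by elim/coset_projW => u; rewrite coset_projM mulg1. Qed.

Fact coset_mulV : left_inverse (coset_proj 1%g) coset_inv coset_mul.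
Proof. by move=> q; rewrite -{2}[q]repr_coset coset_projM mulVg. Qed.

Fact coset_mulrV : right_inverse (coset_proj 1%g) coset_inv coset_mul.
Proof. by move=> q; rewrite -{1}[q]repr_coset coset_projM mulgV. Qed.

HB.instance Definition _ := isGroup.Build coset_space
  coset_mulA coset_mul1 coset_mulr1 coset_mulV coset_mulrV.

(* The smooth structure of G/H is the one for which uH |-> log(u) + h is a
   diffeomorphism onto g/h. *)
Definition coset_chart (q : coset_space) : vquot lie_algebra :=
  vproj lie_algebra (chart (repr q)).
Definition coset_unchart (x : vquot lie_algebra) : coset_space :=
  coset_proj (unchart (repr x)).

Lemma coset_chartE u : coset_chart (coset_proj u) = vproj lie_algebra (chart u).
Proof.
rewrite /coset_chart; apply/vquotP; rewrite -chartV -chartM.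
apply/lie_algebraP; rewrite log_euclidean_mulC; apply/coset_projP.
by rewrite repr_coset.
Qed.

Lemma coset_unchartE x :
  coset_unchart (vproj lie_algebra x) = coset_proj (unchart x).
Proof.
rewrite /coset_unchart; apply/coset_projP/lie_algebraP.
rewrite chartM chartV !unchartK addrC; apply/vquotP.
by rewrite reprK.
Qed.

Fact coset_chartK : cancel coset_chart coset_unchart.
Proof. by elim/coset_projW => u; rewrite coset_chartE coset_unchartE chartK. Qed.

Fact coset_unchartK : cancel coset_unchart coset_chart.
Proof.
by move=> x; rewrite -[x]vliftK coset_unchartE coset_chartE unchartK.
Qed.

Fact coset_chart_continuous : continuous (v2r \o coset_chart).
Proof.
apply/(@quotient_continuous G {eq_quot same_lcoset}).
have -> : (v2r \o coset_chart) \o \pi_(quotient_topology {eq_quot same_lcoset}) =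
  (v2r \o vproj lie_algebra \o r2v) \o (v2r \o chart).
  by apply/funext => u /=; rewrite v2rK -coset_chartE.
move=> u; apply: continuous_comp; first exact: chart_continuous.
exact: (@rV_linear_continuous _ _ _ (v2r \o vproj lie_algebra \o r2v)).
Qed.

Fact coset_unchart_continuous : continuous (coset_unchart \o r2v).
Proof.
have -> : coset_unchart \o r2v =
  coset_proj \o (unchart \o r2v) \o (v2r \o (@vlift _ _ lie_algebra) \o r2v).
  by apply/funext => x /=; rewrite v2rK -coset_unchartE vliftK.
move=> x; apply: continuous_comp.
  exact: (@rV_linear_continuous _ _ _ (v2r \o (@vlift _ _ lie_algebra) \o r2v)).
apply: continuous_comp; first exact: unchart_continuous.
exact: (@pi_continuous G {eq_quot same_lcoset}).
Qed.

HB.instance Definition _ := hasGlobalChart.Build R (vquot lie_algebra)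
  coset_space coset_chartK coset_unchartK
  coset_chart_continuous coset_unchart_continuous.

Let coset_proj_chart :
  chart \o coset_proj \o unchart = vproj lie_algebra :> (g -> vquot lie_algebra).
Proof.
by apply/funext => x; rewrite /= -[LHS]/(coset_chart _) coset_chartE unchartK.
Qed.

(* The projection is a smooth submersion, which characterizes the smooth
   structure of G/H, and the differential of the projection is X |-> X + h. *)
Lemma coset_proj_smooth : smooth coset_proj.
Proof. by rewrite /smooth coset_proj_chart; exact: smooth_vect_linear. Qed.

Lemma tangent_coset_projE u x : tangent_map coset_proj u x = vproj lie_algebra x.
Proof. by rewrite /tangent_map coset_proj_chart diff_vect_linear. Qed.

(* The differential g -> g/h of the projection at the identity. *)
Definition dproj : 'Hom(g, vquot lie_algebra) := tangent_map coset_proj 1%g.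

(* Exactness of 0 -> h -> g -> g/h -> 0. *)
Lemma dproj_exact : lker dproj = lie_algebra /\ limg dproj = fullv.
Proof.
split.
  by apply/vspaceP => x; rewrite memv_ker tangent_coset_projE vproj_eq0.
apply/vspaceP => q; rewrite memvf; apply/memv_imgP.
by exists (vlift q); rewrite ?memvf// tangent_coset_projE vliftK.
Qed.

Definition hom_section (s : coset_space -> G) : Prop :=
  [/\ smooth s, {morph s : p q / (p * q)%g} & cancel s coset_proj].

Definition linear_splitting (l : 'Hom(vquot lie_algebra, g)) : Prop :=
  (dproj \o l)%VF = \1%VF.

End Quotient.

(* Main.v *)
(** A smooth homomorphism between log-Euclidean groups is linear in log
    coordinates: an additive map that is differentiable at 0 coincides with its
    differential there. As G/H is itself log-Euclidean, with logarithm valued in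
    g/h, homomorphisms s : G/H -> G correspond to linear maps l : g/h -> g by
    s = exp o l o log, and pi o s = id reads d(pi) o l = id in these
    coordinates. *)
Require Import Defs.
From HB Require Import structures.
From mathcomp Require Import all_boot all_order all_algebra.
From mathcomp Require Import all_classical all_reals all_analysis.

Set Implicit Arguments.
Unset Strict Implicit.
Unset Printing Implicit Defensive.

Import Order.TTheory GRing.Theory Num.Theory.
Import numFieldNormedType.Exports.
Import VectorInternalTheory.

Local Open Scope classical_set_scope.
Local Open Scope ring_scope.

(** Additivity makes the difference quotient of [f] at 0 along [v] equal to [f v] for every step
    [1/(n+1)], so the directional derivative, a limit of these quotients, is [f v]. Real homogeneity
    of [f] comes out as a consequence. *)
Lemma additive_diff (R : realType) (V W : normedModType R) (f : V -> W) :
  {morph f : x y / x + y} -> differentiable f 0 -> f =1 'd f 0.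
Proof.
move=> fD df v.
have f0 : f 0 = 0 by apply: (addrI (f 0)); rewrite -fD !addr0.
have fMn x n : f (x *+ n) = f x *+ n.
  by elim: n => [|n IH]; rewrite ?mulr0n ?f0// !mulrS fD IH.
(* Derivatives are limits over the punctured neighbourhoods of 0, so the steps [1/(n+1)] must also
   be nonzero. *)
have hC : (@harmonic R n @[n --> \oo]) --> (0 : R)^'.
  move=> P /cvg_harmonic; apply: (@filterS _ \oo) => n; apply.
  exact/lt0r_neq0/harmonic_gt0.
have := cvg_comp _ _ hC (@diff_derivable _ _ _ _ _ v df).
set q := (X in X @ _ --> _) => qC.
have qE : q = cst (f v).
  apply/funext => n; rewrite /q /= addr0 f0 subr0 invrK.
  by rewrite scaler_nat -fMn -scaler_nat scalerA mulfV ?scale1r ?pnatr_eq0.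
rewrite -deriveE//; apply: (cvg_unique _ _ qC) => //.
by rewrite qE; exact: cvg_cst.
Qed.

Section SmoothHomomorphisms.
Variables (R : realType) (V W : vectType R).
Variables (G : logEuclideanType V) (K : logEuclideanType W).

Lemma chart_smooth_morph (f : G -> K) : smooth f ->
  {morph f : u v / (u * v)%g} ->
  forall u, chart (f u) = tangent_map f 1%g (chart u).
Proof.
move=> fs fM u; set F := v2r \o (chart \o f \o unchart) \o r2v.
have [dF _] : Ck 1 F := fs 1%N.
have FD : {morph F : x y / x + y}.
  by move=> x y; rewrite /F /= linearD unchartD fM chartM linearD.
have FE := @additive_diff _ _ _ F FD (dF 0) (v2r (chart u)).
by rewrite /tangent_map /diff_vect lfunE /= chart1 linear0 -FE /F /= !v2rK chartK.
Qed.

Variable l : 'Hom(V, W).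

Definition exp_hom (u : G) : K := unchart (l (chart u)).

Let exp_hom_chart : chart \o exp_hom \o unchart = l.
Proof. by apply/funext => x; rewrite /= /exp_hom !unchartK. Qed.

Lemma exp_hom_smooth : smooth exp_hom.
Proof. by rewrite /smooth exp_hom_chart; exact: smooth_vect_linear. Qed.

Lemma exp_homM : {morph exp_hom : u v / (u * v)%g}.
Proof. by move=> u v; rewrite /exp_hom chartM linearD unchartD. Qed.

Lemma tangent_exp_hom u : tangent_map exp_hom u = l.
Proof.
by apply/lfunP => x; rewrite /tangent_map exp_hom_chart diff_vect_linear.
Qed.

End SmoothHomomorphisms.

Section CosetSpace.
Variables (R : realType) (g : vectType R) (G : logEuclideanType g).
Variable H : closedConnectedSubgroup G.

Lemma chart_coset_proj (u : G) :
  chart (coset_proj H u) = vproj (lie_algebra H) (chart u).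
Proof. exact: coset_chartE. Qed.

(** Makes G/H an instance of [logEuclideanType], so that [chart_smooth_morph] and [exp_hom] apply to
    maps from G/H to G. *)
Fact coset_log_euclidean_mulE (p q : coset_space H) :
  (p * q)%g = unchart (chart p + chart q).
Proof.
elim/coset_projW: p => u; elim/coset_projW: q => v.
rewrite -[LHS]/(coset_mul _ _) coset_projM; apply: (can_inj chartK).
by rewrite unchartK !chart_coset_proj chartM linearD.
Qed.

HB.instance Definition _ :=
  isLogEuclidean.Build R (vquot (lie_algebra H)) (coset_space H)
    coset_log_euclidean_mulE.

End CosetSpace.

Theorem theorem4p11 (R : realType) (g : vectType R) (G : logEuclideanType g)
    (H : closedConnectedSubgroup G) :
  set_bij [set s : coset_space H -> G | hom_section s]
          [set l : 'Hom(vquot (lie_algebra H), g) | linear_splitting l]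
          (fun s : coset_space H -> G => tangent_map s 1%g).
Proof.
split.
- move=> s /= [ss sM sK]; apply/lfunP => q; rewrite comp_lfunE id_lfunE.
  (* The differential of [s] sends [q] to the logarithm of [s (unchart q)], whose class modulo h is
     the logarithm of the coset [unchart q], hence [q]. *)
  have := chart_smooth_morph ss sM (unchart q); rewrite unchartK => <-.
  by rewrite tangent_coset_projE -chart_coset_proj sK unchartK.
(* Injectivity: a smooth homomorphism is determined by its differential at the identity. *)
- move=> s t; rewrite !inE => -[ss sM _] [ts tM _] st.
  apply/funext => q; apply: (can_inj chartK).
  by rewrite (chart_smooth_morph ss sM) st -(chart_smooth_morph ts tM).
- move=> l /= /lfunP lK; exists (exp_hom G l); last exact: tangent_exp_hom.
  split; [exact: exp_hom_smooth | exact: exp_homM |].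
  move=> q; apply: (can_inj chartK); rewrite chart_coset_proj unchartK.
  by have := lK (chart q); rewrite comp_lfunE id_lfunE tangent_coset_projE.
Qed.
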